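(* For $n\in\mathbb{N}$ let $G_n$ be the set of all $\alpha\in F_{\mathbb{N}}$ satisfying at least one of the following three properties: (g1) $\alpha=\xi$; (g2) $\alpha\in\Lambda_n$; (g3) $\alpha\in\Theta_n$, $|M_\alpha^*|\in\{1,\aleph_0\}$ and $M_\alpha^*=M_\alpha^3$. Then $\langle G_n\rangle=F_{\mathbb{N}}$ for all $n\in\mathbb{N}$.
   Context: $\mathbb{N}=\{1,2,3,\ldots\}$. The zig-zag order $\preceq$ on $\mathbb{N}$ is the partial order consisting of the diagonal together with the relation $\prec$ defined, for each $n\in\mathbb{N}$, by $n\prec n+1$ if $n$ is odd and $n+1\prec n$ if $n$ is even. $F_{\mathbb{N}}$ is the semigroup, under composition, of all maps $\alpha:\mathbb{N}\to\mathbb{N}$ such that $x\preceq y$ implies $x\alpha\preceq y\alpha$. Maps are written on the right, so $x(\alpha\beta)=(x\alpha)\beta$. $\langle G\rangle$ denotes the subsemigroup generated by $G$. A non-empty subset of $\mathbb{N}$ is convex if it is an interval (possibly infinite) with respect to the usual order $\le$. For $\alpha\in F_{\mathbb{N}}$: $\mathrm{nb}(\alpha):=\{a\in\mathbb{N}: a\alpha=(a+1)\alpha\}$; $\mathrm{c}(\alpha):=\left|\bigcup\{a\alpha^{-1}: a\in\mathrm{im}\,\alpha,\ |a\alpha^{-1}|\ge 2\}\right|$. $M_\alpha$ is the set of all maximal convex sets $X\subseteq\mathbb{N}$ with $|X\alpha|=1$ (i.e. $X$ is convex, $|X\alpha|=1$, and $|Y\alpha|>1$ for every convex $Y\subseteq\mathbb{N}$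 with $X\subsetneq Y$); here $X$ may be finite or infinite. For $m\in\mathbb{N}$, $M_\alpha^m:=\{X\in M_\alpha: |X|=m\}$, and $M_\alpha^*:=M_\alpha\setminus M_\alpha^1$. $\xi$ is the map $x\xi:=x+2$ for all $x\in\mathbb{N}$. For $n\in\mathbb{N}$: - $\Omega_n:=\{\alpha\in F_{\mathbb{N}}: 1\alpha\ge n,\ |\{1,2,\ldots,n\}\alpha|=n\}$. - $\Lambda_n:=\{\alpha\in \Omega_n: |\mathrm{nb}(\alpha)|=0,\ \mathrm{c}(\alpha)>0\}$. - $\Theta:=\{\alpha\in F_{\mathbb{N}}: a\alpha^{-1}\text{ is a convex set for all }a\in\mathrm{im}\,\alpha\}$ and $\Theta_n:=\Theta\cap\Omega_n$. *)

(* Defs.v *)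
From HB Require Import structures.
From mathcomp Require Import all_boot.
From mathcomp Require Import boolp classical_sets functions cardinality.

Set Implicit Arguments.
Unset Strict Implicit.
Unset Printing Implicit Defensive.

Local Open Scope classical_set_scope.
Local Open Scope card_scope.

(* The natural numbers of the zig-zag order start at 1. *)
Record posnat := PosNat { posnat_val :> nat; posnat_gt0 : (0 < posnat_val)%N }.
HB.instance Definition _ := [isSub for posnat_val].
HB.instance Definition _ := [Countable of posnat by <:].

Definition pone : posnat := PosNat (ltn0Sn 0).
Definition psucc (x : posnat) : posnat := PosNat (ltn0Sn x).

Inductive zigzag_lt : posnat -> posnat -> Prop :=
| ZigzagOdd (n : posnat) : odd n -> zigzag_lt n (psucc n)
| ZigzagEven (n : posnat) : ~~ odd n -> zigzag_lt (psucc n) n.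

Definition zigzag_le (x y : posnat) : Prop := x = y \/ zigzag_lt x y.

Definition F_N : set (posnat -> posnat) :=
  [set alpha | {homo alpha : x y / zigzag_le x y}].

(* Maps are written on the right: x (alpha beta) = (x alpha) beta. *)
Definition mulmap (alpha beta : posnat -> posnat) : posnat -> posnat :=
  beta \o alpha.

Definition subsemigroup (S : set (posnat -> posnat)) : Prop :=
  S `<=` F_N /\
  forall alpha beta, S alpha -> S beta -> S (mulmap alpha beta).

Definition generated (G : set (posnat -> posnat)) : set (posnat -> posnat) :=
  smallest subsemigroup G.

Definition convex (X : set posnat) : Prop :=
  X !=set0 /\
  forall x y z : posnat, X x -> X z -> (x <= y <= z)%N -> X y.

(* In what follows, |A| = k is rendered as A #= `I_k, |A| = aleph_0 as
   A #= [set: nat], |A| >= 2 as `I_2 #<= A, and |A| > k as ~~ (A #<= `I_k). *)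

Definition nb (alpha : posnat -> posnat) : set posnat :=
  [set a | alpha a = alpha (psucc a)].

(* The set whose cardinality is c(alpha). *)
Definition collapse (alpha : posnat -> posnat) : set posnat :=
  \bigcup_(a in [set a | range alpha a /\ `I_2 #<= alpha @^-1` [set a]])
    alpha @^-1` [set a].

Definition M (alpha : posnat -> posnat) : set (set posnat) :=
  [set X | [/\ convex X, alpha @` X #= `I_1 &
    forall Y, convex Y -> X `<` Y -> ~~ (alpha @` Y #<= `I_1)]].

Definition Mcard (alpha : posnat -> posnat) (m : nat) : set (set posnat) :=
  [set X | M alpha X /\ X #= `I_m].

Definition Mstar (alpha : posnat -> posnat) : set (set posnat) :=
  M alpha `\` Mcard alpha 1.

Definition xi (x : posnat) : posnat := psucc (psucc x).

Definition Omega (n : posnat) : set (posnat -> posnat) :=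
  [set alpha | [/\ F_N alpha, (n <= alpha pone)%N &
    alpha @` [set x : posnat | (x <= n)%N] #= `I_n]].

Definition Lambda (n : posnat) : set (posnat -> posnat) :=
  [set alpha | [/\ Omega n alpha, nb alpha #= `I_0 &
    ~~ (collapse alpha #<= `I_0)]].

Definition Theta : set (posnat -> posnat) :=
  [set alpha | F_N alpha /\
    forall a, range alpha a -> convex (alpha @^-1` [set a])].

Definition Theta_ (n : posnat) : set (posnat -> posnat) := Theta `&` Omega n.

Definition G_ (n : posnat) : set (posnat -> posnat) :=
  [set alpha | F_N alpha /\
    [\/ alpha = xi,
        Lambda n alpha |
        [/\ Theta_ n alpha,
            Mstar alpha #= `I_1 \/ Mstar alpha #= [set: nat] &
            Mstar alpha = Mcard alpha 3]]].

(* Main.v *)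
Require Import Defs.
From mathcomp Require Import all_boot.
From mathcomp Require Import boolp classical_sets functions cardinality.
From mathcomp Require Import zify.

(** An element of F_N is a lazy walk on N: it moves by at most one at each step,
    and can move from time x to x + 1 only if its position at time x has the
    parity of x; so all finite maximal runs of repetitions have odd length,
    provided that the walk starts at an odd value.  A walk starting at an even
    value extends backwards by two steps to one starting at an odd value, so
    composing with xi reduces to odd starting values.

    Walks without repetition: preceding such a walk by a long enough descent
    gives an element of Lambda_n, and composing with a power of xi recovers the
    walk.  In particular powers of xi have left inverses in <G_n>.

    General walks: erasing the repetitions of a gives a walk b without
    repetition, and a is b after the map c counting the moves made so far.  Let
    t be the weakly increasing surjection which takes a value three times
    exactly when the corresponding run of a is non-trivial.  Then c is t after a
    walk d without repetition: during a run of any length, even an infinite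
    one, d oscillates between two points of a three-point fibre of t.

    If t has infinitely many three-point fibres, or exactly one, it is obtained
    from generators (g3) by a shift; if it has finitely many, it is a product of
    maps with a single three-point fibre. *)

Set Implicit Arguments.
Unset Strict Implicit.
Unset Printing Implicit Defensive.

Local Open Scope classical_set_scope.
Local Open Scope card_scope.

(** * Order-preserving maps as lazy walks *)

(* Position k of a walk stands for the element k + 1 of N, so parities are
   swapped with respect to the zig-zag order. *)
Definition pos (k : nat) : posnat := PosNat (ltn0Sn k).

Definition posmap (a : nat -> nat) (x : posnat) : posnat := pos (a x.-1).

Definition walk (a : nat -> nat) : Prop :=
  forall x, a x = a x.+1 \/
    odd (a x) = odd x /\ (a x.+1 = (a x).+1 \/ a x = (a x.+1).+1).

Definition strict (a : nat -> nat) : Prop :=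
  forall x, odd (a x) = odd x /\ (a x.+1 = (a x).+1 \/ a x = (a x.+1).+1).

Lemma strict_walk a : strict a -> walk a.
Proof. by move=> sa x; right. Qed.

Lemma pos_predK (x : posnat) : pos x.-1 = x.
Proof. by apply: val_inj => /=; rewrite prednK // posnat_gt0. Qed.

Lemma pos_inj : injective pos.
Proof. by move=> i j []. Qed.

Lemma posmap_pos a k : posmap a (pos k) = pos (a k).
Proof. by []. Qed.

Lemma zigzag_ltP x y : zigzag_lt x y <->
  odd x /\ y = x.+1 :> nat \/ ~~ odd y /\ x = y.+1 :> nat.
Proof.
split=> [[n on|n en]|]; [by left|by right|].
case=> [[ox yx]|[ey xy]].
  by rewrite (_ : y = psucc x); [exact: ZigzagOdd|exact: val_inj].
by rewrite (_ : x = psucc y); [exact: ZigzagEven|exact: val_inj].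
Qed.

(** Distinct comparable elements are consecutive, so only single steps matter; the direction of the
    comparison at time [x] forces the parity of [a x] whenever the walk moves. *)
Lemma posmap_F_N a : F_N (posmap a) <-> walk a.
Proof.
split=> [Fa x|wa x y].
  have [ox|ex] := boolP (odd x).
    have /Fa : zigzag_le (pos x.+1) (pos x).
      by right; apply/zigzag_ltP; right => /=; lia.
    case=> [[]|/zigzag_ltP]; first by left.
    by rewrite /=; lia.
  have /Fa : zigzag_le (pos x) (pos x.+1).
    by right; apply/zigzag_ltP; left => /=; lia.
  case=> [[]|/zigzag_ltP]; first by left.
  by rewrite /=; lia.
case=> [->|]; first by left.
rewrite -[x]pos_predK -[y]pos_predK; move: x.-1 y.-1 => {x y} i j.
move=> /zigzag_ltP /= ij.
have {}ij : ~~ odd i /\ j = i.+1 \/ odd j /\ i = j.+1 by lia.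
rewrite !posmap_pos; have [e|ne] := eqVneq (a i) (a j).
  by left; rewrite e.
right; apply/zigzag_ltP => /=.
by case: ij => -[e ij]; subst; [case: (wa i)|case: (wa j)] => ?; lia.
Qed.

Lemma F_N_posmap alpha : F_N alpha -> exists2 a, walk a & alpha = posmap a.
Proof.
move=> Fa; have E : alpha = posmap (fun k => (alpha (pos k)).-1).
  by apply/funext => x; rewrite /posmap !pos_predK.
by exists (fun k => (alpha (pos k)).-1) => //; apply/posmap_F_N; rewrite -E.
Qed.

(** * Generated subsemigroups and cardinalities *)

Lemma subsemigroup_F_N : subsemigroup F_N.
Proof. by split=> // al be Fa Fb x y xy; apply: Fb; apply: Fa. Qed.

Lemma generated_mul G al be :
  generated G al -> generated G be -> generated G (mulmap al be).
Proof.
move=> ga gb S HS; case: (HS) => [[_ SM] _].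
by apply: SM; [exact: ga|exact: gb].
Qed.

Lemma G_sub_F_N n : G_ n `<=` F_N.
Proof. by move=> al []. Qed.

Lemma card_ge2 (X : set posnat) x y : X x -> X y -> x != y -> `I_2 #<= X.
Proof.
move=> Xx Xy nxy; pose h i := if i == 0 then x else y.
have /card_esym : h @` `I_2 #= `I_2.
  apply: inj_card_eq => i j; rewrite !in_setE /= /h => i2 j2.
  by case: eqP; case: eqP => ? ? E; move: nxy; rewrite ?E ?eqxx; lia.
rewrite card_eq_le => /andP[le2 _]; apply: card_le_trans le2 _.
by apply: subset_card_le => _ [i _ <-]; rewrite /h; case: eqP.
Qed.

Lemma card_le1_eq (X : set posnat) x y : X #<= `I_1 -> X x -> X y -> x = y.
Proof.
move=> X1 Xx Xy; apply/eqP/negPn/negP => /(card_ge2 Xx Xy) X2.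
by have := card_le_trans X2 X1; rewrite card_le_II.
Qed.

Lemma card_image_le_ord (f : posnat -> posnat) (n : posnat) :
  (forall i j, i < n -> j < n -> f (pos i) = f (pos j) -> i = j) ->
  f @` [set x : posnat | (x <= n)%N] #= `I_n.
Proof.
move=> finj.
have -> : f @` [set x : posnat | (x <= n)%N] = (f \o pos) @` `I_n.
  apply/seteqP; split=> [_ [x /= xn <-]|_ [k /= kn <-]]; last by exists (pos k).
  by exists x.-1; rewrite /= ?pos_predK //; move: (posnat_gt0 x); lia.
apply: inj_card_eq => i j; rewrite !in_setE /=; exact: finj.
Qed.

Variant gens (n : posnat) (a : nat -> nat) : Prop :=
  Gens of generated (G_ n) (posmap a).

Lemma gens_comp n a b : gens n a -> gens n b -> gens n (b \o a).
Proof. by move=> [ga] [gb]; split; exact: (@generated_mul _ _ _ ga gb). Qed.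

Lemma gens_ext n a b : gens n a -> a =1 b -> gens n b.
Proof. by move=> ga /funext <-. Qed.

(** * Walks without repetition *)

(** Turning back would repeat a value, so an injective walk that starts downwards would descend
    forever. This gives c(alpha) > 0 in [strict_Lambda]. *)
Lemma strict_inj_collapse a : strict a -> a 0 = (a 1).+1 -> ~ injective a.
Proof.
move=> sa a01 ia.
have dec x : a x = (a x.+1).+1.
  elim: x => // x IH; case: (sa x.+1) => _ [] // e.
  have /ia : a x = a x.+2 by lia.
  by lia.
have sum x : a x + x = a 0 by elim: x => [|x IH]; [lia|have := dec x; lia].
by have := sum (a 0).+1; lia.
Qed.

Lemma strict_Lambda (n : posnat) a : strict a -> n <= a 0 ->
  (forall i, i <= n -> a i = a 0 - i) -> Lambda n (posmap a).
Proof.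
move=> sa na ai.
have inj i j : i < n -> j < n -> posmap a (pos i) = posmap a (pos j) -> i = j.
  by move=> ilt jlt /pos_inj /=; rewrite (ai i) ?(ai j); lia.
have n0 := posnat_gt0 n.
split; first split.
- exact/posmap_F_N/strict_walk.
- by rewrite /=; lia.
- exact: card_image_le_ord.
- rewrite II0 card_eq0; apply/eqP/seteqP; split => // x.
  rewrite /nb /= -[x]pos_predK.
  rewrite -[psucc _]/(pos x.-1.+1) !posmap_pos => /pos_inj.
  by case: (sa x.-1); lia.
- rewrite II0 card_le0; apply/set0P; apply: contrapT => C0.
  apply: (strict_inj_collapse sa); first by have := ai 1; lia.
  move=> x y axy; apply/eqP/negPn/negP => nxy; apply: C0.
  exists (pos x); exists (posmap a (pos x)) => //; split.
    by exists (pos x).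
  apply: (@card_ge2 _ (pos x) (pos y)) => //=.
  by rewrite !posmap_pos axy.
Qed.

Lemma gens_xi n : gens n (addn 2).
Proof.
split; apply: sub_gen_smallest.
have E : posmap (addn 2) = xi.
  by apply/funext => x; apply: val_inj => /=; move: (posnat_gt0 x); lia.
by rewrite E; split; [rewrite -E; apply/posmap_F_N => x; lia|constructor 1].
Qed.

Lemma gens_shift n k : gens n (addn k.*2.+2).
Proof.
elim: k => [|k IH]; first exact: gens_xi.
by refine (gens_ext (gens_comp IH (gens_xi n)) _) => x /=; lia.
Qed.

Lemma gens_strict n a : strict a -> gens n a.
Proof.
(* [K] is the shift provided by [gens_shift n n]; as it is even, a descent of length [K] followed by
   [a] keeps the right parities. *)
move=> sa; pose K := (n : nat).*2.+2.
have [eK nK] : ~~ odd K /\ n <= K by rewrite /K; lia.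
pose b x := if x <= K then a 0 + (K - x) else a (x - K).
have bE (x : nat) : b (x + K) = a x.
  rewrite /b addnK; case: leqP => // xK.
  have -> : x = 0 by lia.
  by rewrite add0n subnn addn0.
have bK x : x <= K -> b x = a 0 + (K - x) by rewrite /b => ->.
suff gb : gens n b.
  refine (gens_ext (gens_comp (gens_shift n n) gb) _) => x /=.
  by rewrite -(bE x) addnC.
have sb : strict b.
  move=> x; have [xK|Kx] := leqP K x.
    rewrite -(subnK xK) -addSn !bE.
    by have := sa (x - K); lia.
  by have := sa 0; rewrite !bK; lia.
split; apply: sub_gen_smallest; split; first exact/posmap_F_N/strict_walk.
constructor 2; apply: strict_Lambda => //; first by rewrite bK; lia.
by move=> i ilen; rewrite !bK; lia.
Qed.

(** * Surjections with fibres of one or three points *)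

(** A state is a pair (i, r), with i the current value and r the offset inside the fibre over i. *)
Definition next_state (A : pred nat) (s : nat * nat) : nat * nat :=
  if s.2 < (A s.1).*2 then (s.1, s.2.+1) else (s.1.+1, 0).

Definition state (A : pred nat) (y : nat) : nat * nat :=
  iter y (next_state A) (0, 0).

(* The weakly increasing surjection whose fibre over i has three points if
   [A i] holds, and one point otherwise; [start A i] is the least point of the
   fibre over i. *)
Definition triple (A : pred nat) (y : nat) : nat := (state A y).1.

Fixpoint start (A : pred nat) (i : nat) : nat :=
  if i is j.+1 then start A j + (A j).*2.+1 else 0.

Lemma stateS (A : pred nat) y : state A y.+1 = next_state A (state A y).
Proof. by []. Qed.

Lemma stateP (A : pred nat) y : (state A y).2 <= (A (triple A y)).*2 /\
  start A (triple A y) + (state A y).2 = y.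
Proof.
elim: y => // y; rewrite /triple stateS /next_state.
by case: (state A y) => i r /= [ri IH]; case: ltnP => /=; lia.
Qed.

Lemma start_lt (A : pred nat) i j : i < j -> start A i + (A i).*2 < start A j.
Proof.
by elim: j => // j IH; rewrite ltnS leq_eqVlt => /orP[/eqP ->|/IH] /=; lia.
Qed.

Lemma triple_start (A : pred nat) i r :
  r <= (A i).*2 -> triple A (start A i + r) = i.
Proof.
move=> ri; have [] := stateP A (start A i + r).
move: (triple _ _) (state _ _).2 => j s sj e.
by case: (ltngtP i j) => // /(start_lt A); lia.
Qed.

Lemma triple_inv (A : pred nat) y :
  exists2 r, r <= (A (triple A y)).*2 & y = start A (triple A y) + r.
Proof. by have [] := stateP A y; exists (state A y).2. Qed.

(** Fibres have odd size, so both the first and the last point of the fibre over i have the parity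
    of i. *)
Lemma tripleS (A : pred nat) y : triple A y = triple A y.+1 \/
  odd (triple A y) = odd y /\ triple A y.+1 = (triple A y).+1.
Proof.
have oS i : odd (start A i) = odd i by elim: i => //= i; lia.
have := stateP A y; rewrite /triple stateS /next_state.
case: (state A y) => i r /= [ri yE]; case: ltnP => /= ri2; [by left|right].
by split=> //; move: (oS i); lia.
Qed.

Lemma triple_le (A : pred nat) x y : x <= y -> triple A x <= triple A y.
Proof.
elim: y => [|y IH]; first by rewrite leqn0 => /eqP ->.
rewrite leq_eqVlt => /orP[/eqP -> //|/IH]; case: (tripleS A y); lia.
Qed.

Lemma walk_triple (A : pred nat) : walk (triple A).
Proof. by move=> x; case: (tripleS A x); [left|right; lia]. Qed.

Lemma start_id (A : pred nat) n i :
  (forall j, A j -> n <= j) -> i <= n -> start A i = i.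
Proof.
move=> An; elim: i => //= i IH ilt.
case: (boolP (A i)) => [/An|_]; rewrite ?IH; lia.
Qed.

Lemma triple_id (A : pred nat) n x :
  (forall j, A j -> n <= j) -> x <= n -> triple A x = x.
Proof.
by move=> An xn; rewrite -{1}(start_id An xn) -(addn0 (start _ _)) triple_start.
Qed.

(** * Kernel classes of these surjections *)

Definition fiber (A : pred nat) (i : nat) : set posnat :=
  [set x | triple A x.-1 = i].

Lemma card_fiber (A : pred nat) i : fiber A i #= `I_((A i).*2.+1).
Proof.
have -> : fiber A i = (pos \o addn (start A i)) @` `I_((A i).*2.+1).
  apply/seteqP; split=> [x xi|_ [r /= ri <-]]; last exact: triple_start.
  have [r] := triple_inv A x.-1; rewrite xi => rA xE.
  by exists r => //=; rewrite -xE pos_predK.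
by apply: inj_card_eq => r s _ _ /pos_inj; lia.
Qed.

Lemma convex_fiber (A : pred nat) i : convex (fiber A i).
Proof.
split; first by exists (pos (start A i + 0)); exact: triple_start.
move=> x y z; rewrite /fiber /= => xi zi /andP[xy yz].
have := @triple_le A x.-1 y.-1; have := @triple_le A y.-1 z.-1; lia.
Qed.

Lemma fiber_inj (A : pred nat) : injective (fiber A).
Proof.
move=> i j ij; have : fiber A j (pos (start A i + 0)).
  by rewrite -ij; exact: triple_start.
by rewrite /fiber /= triple_start.
Qed.

Lemma M_triple (A : pred nat) k :
  M (posmap (fun y => k + triple A y)) = range (fiber A).
Proof.
set al := posmap _.
have alE x y : al x = al y <-> triple A x.-1 = triple A y.-1.
  by split=> [/pos_inj|e]; [lia|rewrite /al /posmap e].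
have al1 i : al @` fiber A i = [set pos (k + i)].
  apply/seteqP; split=> [_ [x xi <-]|_ ->]; first by rewrite /al /posmap xi.
  exists (pos (start A i + 0)); first exact: triple_start.
  by rewrite /al posmap_pos triple_start.
apply/seteqP; split=> [X [[[x Xx] _] X1 Xmax]|_ [i _ <-]].
  have XF : X `<=` fiber A (triple A x.-1).
    move=> y Xy; apply/alE; apply: (@card_le1_eq (al @` X)).
    - by move: X1; rewrite card_eq_le => /andP[].
    - by exists y.
    - by exists x.
  exists (triple A x.-1) => //; apply/seteqP; split=> //; apply: contrapT => FX.
  have /negP := Xmax _ (convex_fiber A (triple A x.-1)) (conj XF FX).
  rewrite al1; apply; move: (@card_set1 _ (pos (k + triple A x.-1))).
  by rewrite card_eq_le => /andP[].
split; first exact: convex_fiber.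
  by rewrite al1; exact: card_set1.
move=> Y _ [FY YF]; apply/negP => Y1; apply: YF => y Yy.
have [x xi] : fiber A i !=set0 by case: (convex_fiber A i).
rewrite /fiber /= -xi; apply/alE; apply: (card_le1_eq Y1); first by exists y.
by exists x => //; apply: FY.
Qed.

Lemma Mcard_triple (A : pred nat) k m :
  Mcard (posmap (fun y => k + triple A y)) m =
  fiber A @` [set i | (A i).*2.+1 = m].
Proof.
apply/seteqP; split=> [X [] |_ [i im <-]].
  rewrite M_triple => -[i _ <-]; rewrite (card_eql (card_fiber A i)) => im.
  by exists i => //=; exact/card_eq_II.
split; first by rewrite M_triple; exists i.
by rewrite -im; exact: card_fiber.
Qed.

Lemma Mstar_triple (A : pred nat) k :
  Mstar (posmap (fun y => k + triple A y)) = fiber A @` [set i | A i].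
Proof.
rewrite /Mstar Mcard_triple M_triple; apply/seteqP; split.
  move=> _ [[i _ <-] ni]; exists i => //=; apply/negPn/negP => nA; apply: ni.
  by exists i => //=; lia.
move=> _ [i /= Ai <-]; split; first by exists i.
by move=> [j /= jA /fiber_inj ji]; move: jA; rewrite ji Ai.
Qed.

(** * Generating the surjections *)

(** For membership in [Omega n], the shift makes the first value large enough, and the absence of
    three-point fibres below [n] makes the first [n] values distinct. *)
Lemma gens_shift_triple (n : posnat) (A : pred nat) k :
  (forall i, A i -> n <= i) -> n <= k.*2 ->
  (exists N, A =1 pred1 N) \/ infinite_set [set i | A i] ->
  gens n (fun y => k.*2 + triple A y).
Proof.
move=> An nk Acard; split; apply: sub_gen_smallest.
have W : walk (fun y => k.*2 + triple A y).
  by move=> x; have := walk_triple A x; lia.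
have FW : F_N (posmap (fun y => k.*2 + triple A y)) by exact/posmap_F_N.
split=> //; constructor 3; split.
- split; split=> //.
  + move=> _ [x _ <-]; have := convex_fiber A (triple A x.-1).
    congr convex; apply/seteqP; split=> y; rewrite /fiber /=.
      by rewrite /posmap => ->.
    by move=> /pos_inj; lia.
  + by rewrite /=; lia.
  + apply: card_image_le_ord => i j ilt jlt; rewrite !posmap_pos => /pos_inj.
    by rewrite !(triple_id An); lia.
- rewrite Mstar_triple; have inj : {in [set i | A i] &, injective (fiber A)}.
    by move=> i j _ _ /fiber_inj.
  rewrite !(card_eql (inj_card_eq inj)).
  case: Acard => [[N AN]|Ainf]; [left|right].
    suff -> : [set i | A i] = [set N] by exact: card_set1.
    by apply/seteqP; split=> i /=; rewrite AN => /eqP.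
  by apply: eq_card_nat.
- rewrite Mstar_triple Mcard_triple; congr image; apply/seteqP.
  by split=> i /=; lia.
Qed.

Lemma gens_triple_far (n : posnat) (A : pred nat) :
  (forall i, A i -> n <= i) ->
  (exists N, A =1 pred1 N) \/ infinite_set [set i | A i] -> gens n (triple A).
Proof.
move=> An Acard.
pose k := n : nat; have nk : n <= k.*2 by rewrite /k; lia.
(* Subtraction is truncated, so [w x] is the distance from x to 2k: a strict walk that undoes the
   shift. *)
pose w x := (k.*2 - x) + (x - k.*2).
have sw : strict w by move=> x; rewrite /w; lia.
refine (gens_ext (gens_comp (gens_shift_triple An nk Acard)
  (gens_strict n sw)) _).
by move=> x /=; rewrite /w; lia.
Qed.

(** The shifted automaton reaches the state (k, 0) at time k; from then on the two run in
    parallel. *)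
Lemma triple_shift (A : pred nat) k x :
  triple (fun i => (k <= i) && A (i - k)) (x + k) = triple A x + k.
Proof.
set B := fun i => _.
have Bk : forall i, B i -> k <= i by move=> i /andP[].
rewrite /triple.
suff -> : state B (x + k) = ((state A x).1 + k, (state A x).2) by [].
elim: x => [|x IH].
  have [_] := stateP B k.
  rewrite (triple_id Bk (leqnn k)) (start_id Bk (leqnn k)) => r0.
  rewrite add0n (surjective_pairing (state B k)) -/(triple B k).
  by rewrite (triple_id Bk (leqnn k)) /=; congr (_, _); lia.
rewrite addSn !stateS IH; case: (state A x) => i r; rewrite /next_state /=.
by rewrite /B leq_addl addnK /=; case: ifP.
Qed.

(** Three-point fibres over small values are moved up by an even [k], where [gens_triple_far]
    applies; a shift before and its left inverse [w] after bring them back. *)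
Lemma gens_triple_infinite_or_single (n : posnat) (A : pred nat) :
  (exists N, A =1 pred1 N) \/ infinite_set [set i | A i] -> gens n (triple A).
Proof.
move=> Acard; pose k := (n : nat).*2; set B := fun i => (k <= i) && A (i - k).
have nk : ~~ odd k /\ n <= k by rewrite /k; lia.
have Bn i : B i -> n <= i by rewrite /B; lia.
have Bcard : (exists N, B =1 pred1 N) \/ infinite_set [set i | B i].
  case: Acard => [[N AN]|Ainf]; [left|right].
    by exists (N + k) => i; rewrite /B AN /=; lia.
  apply: contra_not Ainf => Bfin.
  have : finite_set ((fun i => i - k) @` [set i | B i]) by exact: finite_image.
  apply: sub_finite_set => i /= Ai; exists (i + k); rewrite /= ?addnK //.
  by rewrite /B leq_addl addnK.
pose w x := (k - x) + (x - k).
have ss : strict (addn^~ k) by move=> x /=; lia.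
have sw : strict w by move=> x; rewrite /w; lia.
refine (gens_ext (gens_comp (gens_comp (gens_strict n ss)
  (gens_triple_far Bn Bcard)) (gens_strict n sw)) _).
by move=> x /=; rewrite triple_shift /w; lia.
Qed.

(** The factor acting first collapses the fibres below [N] and is a translation from there on. It
    spreads the fibre over [N] onto N, N + 1, N + 2, which the second factor merges. *)
Lemma triple_remove_max (A : pred nat) N : A N -> (forall i, A i -> i <= N) ->
  triple A =1 triple (pred1 N) \o triple (fun i => A i && (i < N)).
Proof.
move=> AN Amax y /=; set B := fun i => _.
have startS C i : start C i.+1 = start C i + (C i).*2.+1 by [].
have below i : i <= N -> start A i = start B i /\ start (pred1 N) i = i.
  elim: i => // i IH iN; have [|IH1 IH2] := IH; first lia.
  by rewrite !startS IH1 IH2 /B /=; lia.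
have [BN idN] := below N (leqnn N).
have aboveA q : start A (N.+1 + q) = start A N + 3 + q.
  elim: q => [|q IH]; first by rewrite addn0 startS AN; lia.
  by rewrite addnS startS IH; have := Amax (N.+1 + q); lia.
have aboveB q : start B (N + q) = start A N + q.
  by elim: q => [|q IH]; [rewrite !addn0|rewrite addnS startS IH /B; lia].
have above1 q : start (pred1 N) (N.+1 + q) = N + 3 + q.
  elim: q => [|q IH]; first by rewrite addn0 startS idN /= eqxx; lia.
  by rewrite addnS startS IH /=; lia.
have at_start C i : triple C (start C i) = i.
  by rewrite -[start C i]addn0 triple_start.
have [r] := triple_inv A y; set i := triple A y => ri ->.
have [iN|Ni|iN] := ltngtP i N.
- have [-> i1] := below i (ltnW iN).
  rewrite triple_start; last by rewrite /B; lia.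
  by rewrite -{2}i1 at_start.
- have -> : i = N.+1 + (i - N.+1) by lia.
  set q := i - N.+1; have := Amax i => Ai.
  have -> : r = 0 by lia.
  rewrite aboveA addn0 -addnA -aboveB at_start addnA -above1 at_start.
  by lia.
- move: ri; rewrite iN AN => r2; rewrite -aboveB at_start.
  by rewrite -[X in _ (X + r)]idN triple_start //= eqxx.
Qed.

Lemma gens_triple (n : posnat) (A : pred nat) : gens n (triple A).
Proof.
have [Afin|Ainf] := pselect (exists N, forall i, A i -> i < N); last first.
  apply: gens_triple_infinite_or_single; right.
  move=> /finite_seqP[s As]; apply: Ainf.
  exists (\max_(i <- s) i).+1 => i Ai; rewrite ltnS.
  have : [set` s] i by rewrite -As.
  by move=> /= si; rewrite (big_rem i) //= leq_maxl.
have id0 (B : pred nat) : (forall i, ~~ B i) -> gens n (triple B).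
  move=> B0; apply: gens_strict => x.
  by rewrite !(@triple_id B x.+1) //; [lia|move=> i; rewrite (negbTE (B0 i))..].
(* The induction is on a strict upper bound of [A]; the fibre over the largest candidate [N] is
   split off when [N] is in [A]. *)
case: Afin => N; elim: N A => [|N IH] A AN.
  by apply: id0 => i; apply/negP => /AN.
have [ANN|nAN] := boolP (A N); last first.
  apply: IH => i Ai; have := AN i Ai; rewrite ltnS leq_eqVlt => /orP[/eqP e|//].
  by move: nAN; rewrite -e Ai.
have gB : gens n (triple (fun i => A i && (i < N))) by apply: IH => i /andP[].
have g1 : gens n (triple (pred1 N)).
  by apply: gens_triple_infinite_or_single; left; exists N.
refine (gens_ext (gens_comp gB g1) _) => y.
by rewrite [RHS](triple_remove_max ANN).
Qed.

(** * Factoring a walk through its number of moves *)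

Fixpoint moves (a : nat -> nat) (x : nat) : nat :=
  if x is y.+1 then moves a y + (a y != a y.+1) else 0.

Lemma movesS a x : moves a x.+1 = moves a x + (a x != a x.+1).
Proof. by []. Qed.

Lemma moves_le a x y : x <= y -> moves a x <= moves a y.
Proof.
elim: y => [|y IH]; first by rewrite leqn0 => /eqP ->.
rewrite leq_eqVlt => /orP[/eqP -> //|/IH xy]; rewrite movesS; lia.
Qed.

Lemma moves_inj a x y : moves a x = moves a y -> a x = a y.
Proof.
wlog xy : x y / x <= y => [H|].
  by case: (leqP x y) => [|/ltnW] xy e; [|symmetry]; apply: H.
elim: y xy => [|y IH]; first by rewrite leqn0 => /eqP ->.
rewrite leq_eqVlt => /orP[/eqP -> //|/[dup] xy /IH {}IH].
have := @moves_le a x y xy; rewrite movesS.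
by case: eqP => [<- ? ?|_ /= ? ?]; [apply: IH; lia|lia].
Qed.

(** The count grows by at most one at a time; the time found is the last one with count [i], as a
    move follows it. *)
Lemma moves_onto a x i : i < moves a x ->
  exists y, moves a y = i /\ a y <> a y.+1.
Proof.
elim: x => // x IH; rewrite movesS => ix.
have [|ni] := ltnP i (moves a x); first exact: IH.
by exists x; move: ix; case: eqP => ? /= ?; split=> //; lia.
Qed.

Lemma odd_moves a x : walk a -> ~~ odd (a 0) -> odd (a x) = odd (moves a x).
Proof.
move=> wa a0; elim: x => [|x IH]; first by rewrite (negbTE a0).
by rewrite movesS; case: (wa x); case: eqP => /=; lia.
Qed.

(* An eventually constant walk makes finitely many moves; there b is prolonged
   by an oscillation. *)
Lemma strict_of_moves a : walk a -> ~~ odd (a 0) ->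
  exists2 b, strict b & b \o moves a =1 a.
Proof.
move=> wa a0; pose P i x := moves a x = i.
have Pd i : ~ (exists x, P i x) -> ~ (exists x, P i.+1 x).
  move=> nP [x]; rewrite /P => Px; apply: nP.
  by have [|y [yi _]] := @moves_onto a x i; [lia|exists y].
(* The attained counts form an initial segment, so at most one of them is last: [v] is the value of
   the walk there, or 0 if there is no last count. *)
have [v vP] : exists v, forall i x, P i x -> ~ (exists y, P i.+1 y) -> a x = v.
  have [[i [[x Px] nP]]|nE] :=
    pselect (exists i, (exists x, P i x) /\ ~ exists y, P i.+1 y).
    exists (a x) => j y Py nPj; apply: moves_inj; rewrite Px Py.
    have H k l : (exists x, P k x) -> ~ (exists x, P l.+1 x) -> k <= l.
      move=> [z Pz]; case: leqP => // lk nPl.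
      elim: k lk z Pz => // k IH.
      rewrite ltnS leq_eqVlt => /orP[/eqP <-|lk] z Pz.
        by case: nPl; exists z.
      have [[w Pw]|/Pd[]] := pselect (exists x, P k x); last by exists z.
      exact: IH lk w Pw.
    by apply/eqP; rewrite eqn_leq !H //; [exists x|exists y].
  by exists 0 => i x Px nP; case: nE; exists i; split=> //; exists x.
(* Beyond the last count, [b] alternates between v and v + 1, the added bit giving it the parity of
   [i]. *)
pose b i := if pselect (exists x, P i x) is left e then a (xget 0 (P i))
            else v + (odd i (+) odd v).
have bE i x : P i x -> b i = a x.
  move=> Pix; rewrite /b; case: pselect => [e|[]]; last by exists x.
  by apply: moves_inj; rewrite Pix; exact: (@xgetPex _ 0 (P i) e).
have bN i : ~ (exists x, P i x) -> b i = v + (odd i (+) odd v).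
  by move=> nP; rewrite /b; case: pselect.
exists b; last by move=> x; exact: bE.
move=> i; have [[x Px]|nP] := pselect (exists x, P i.+1 x).
  have [|y [yi ya]] := @moves_onto a x i; first by rewrite Px.
  have yi1 : P i.+1 y.+1 by rewrite /P movesS yi; case: eqP ya => //= _ _; lia.
  rewrite (bE _ _ yi) (bE _ _ yi1); have := odd_moves y wa a0; rewrite yi.
  by case: (wa y) => ?; lia.
rewrite (bN _ nP); have [[x Px]|nPi] := pselect (exists x, P i x).
  have := odd_moves x wa a0; rewrite (bE _ _ Px) (vP _ _ Px nP) Px; lia.
by rewrite (bN _ nPi); lia.
Qed.

(* Inside a run of repetitions, d oscillates between the first two points of a
   three-point fibre; it steps on the third point when the run ends. *)
Lemma moves_triple a : walk a -> ~~ odd (a 0) ->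
  exists (A : pred nat) d, strict d /\ triple A \o d =1 moves a.
Proof.
move=> wa a0; pose A i := `[< exists x, moves a x = i /\ a x = a x.+1 >].
(* During a rest, the offset is the bit that gives [start A (moves a x) + e x] the parity of [x];
   before a move, [a x] already has that parity and the offset, 0 or 2, is even. *)
pose e x : nat := if a x == a x.+1 then odd (a x) (+) odd x : nat
             else (A (moves a x)).*2.
have om x := odd_moves x wa a0.
have eA x : e x <= (A (moves a x)).*2.
  rewrite /e; case: eqP => // ax.
  have -> : A (moves a x); last by case: (_ (+) _).
  by apply/asboolP; exists x.
exists A, (fun x => start A (moves a x) + e x); split; last first.
  by move=> x /=; exact: triple_start.
have oS i : odd (start A i) = odd i by elim: i => //= i; lia.
move=> x; split.
  have := oS (moves a x); have := om x; have := wa x; rewrite /e.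
  by case: eqP => ax; lia.
have [ax|ax] := eqVneq (a x) (a x.+1).
  have m1 : moves a x.+1 = moves a x by rewrite movesS ax eqxx addn0.
  have Ax : A (moves a x) by apply/asboolP; exists x.
  rewrite m1 /e ax eqxx m1 Ax; case: eqP => ax1; first by lia.
  by have := wa x.+1; lia.
have m1 : moves a x.+1 = (moves a x).+1 by rewrite movesS ax addn1.
have ex : e x = (A (moves a x)).*2 by rewrite /e (negbTE ax).
suff e1 : e x.+1 = 0 by left; rewrite e1 ex m1 /=; lia.
rewrite /e; case: eqP => ax1; first by have := wa x; lia.
suff -> : A (moves a x.+1) = false by [].
(* The walk moves just before and just after time x + 1, so no other time has the same count. *)
apply/asboolP => -[y [my ay]].
have [yx|xy|yx] := ltngtP y x.+1.
- by have := @moves_le a y x; lia.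
- have := @moves_le a x.+2 y xy; rewrite movesS; lia.
- by apply: ax1; rewrite -yx.
Qed.

(** * Generating all walks *)

Lemma gens_even n a : walk a -> ~~ odd (a 0) -> gens n a.
Proof.
move=> wa a0; have [b sb ba] := strict_of_moves wa a0.
have [A [d [sd Ad]]] := moves_triple wa a0.
refine (gens_ext (gens_comp (gens_comp (gens_strict n sd) (gens_triple n A))
  (gens_strict n sb)) _) => x.
by rewrite -ba /= -Ad.
Qed.

Lemma gens_walk n a : walk a -> gens n a.
Proof.
move=> wa; have [a0|a0] := boolP (odd (a 0)); last exact: gens_even.
(* The rest at time 1 makes the delay equal to two, the shift of [xi]. *)
pose b x := match x with 0 => (a 0).+1 | 1 => a 0 | y.+2 => a y end.
have gb : gens n b.
  apply: gens_even => /=; last by rewrite a0.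
  by case=> [|[|x]] /=; [lia|lia|have := wa x; lia].
exact: (gens_ext (gens_comp (gens_xi n) gb)).
Qed.

Theorem theorem3p5 (n : posnat) : generated (G_ n) = F_N.
Proof.
apply/seteqP; split.
  exact: smallest_sub subsemigroup_F_N (@G_sub_F_N n).
by move=> al /F_N_posmap[a wa ->]; case: (gens_walk n wa).
Qed.
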